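(* Let $G=(V,E)$ be a finite simple graph with $V$ identified with $\{1,\ldots,|V|\}$. Formulation (F1) is the projection of formulation (F2), with the integrality of the $d$-variables relaxed, obtained by projecting out the $d$-variables. That is, for every $x\in\{0,1\}^{|V|\times|V|}$ satisfying $\sum_{i}x^k_i=1$ for all $k$ and $\sum_k x^k_i=1$ for all $i$, and for every $\theta=(\theta_e)_{e\in E}$ with $\theta_e\ge 0$, the following are equivalent: (i) $(x,\theta)$ is feasible for (F1), i.e. $\theta_e\ge k-\sum_{l<k}(k-l)(x^l_i+x^l_{i'})$ for all $k\in\{1,\ldots,|V|\}$ and all $e=\{i,i'\}\in E$; (ii) there exists $d=(d^k_e)_{e\in E,\,1\le k\le|V|}$ with $d^k_e\ge0$ such that $\sum_{k=1}^{|V|}d^k_e=1$ for all $e\in E$, $d^k_e\le x^k_i+x^k_{i'}$ for all $k$ and all $e=\{i,i'\}\in E$, and $\theta_e\ge\sum_{k=1}^{|V|}k\,d^k_e$ for all $e\in E$.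
   Context: The $S$-labeling problem: for a graph $G=(V,E)$, find a labeling (bijection) $\phi:V\to\{1,\ldots,|V|\}$ minimizing $SL_\phi(G)=\sum_{\{u,v\}\in E}\min\{\phi(u),\phi(v)\}$. Both formulations below use binary variables $x^k_i$, $i,k\in\{1,\ldots,|V|\}$, where $x^k_i=1$ means node $i$ gets label $k$, with the constraints $\sum_i x^k_i=1$ for all $k$ and $\sum_k x^k_i=1$ for all $i$. (F1): minimize $\sum_{e\in E}\theta_e$ subject to $\sum_i x^k_i=1$ for all $k\in\{1,\ldots,|V|\}$, $\sum_k x^k_i=1$ for all $i\in\{1,\ldots,|V|\}$, $x^k_i\in\{0,1\}$ for all $i,k\in\{1,\ldots,|V|\}$, $\theta_e\ge 0$, and $\theta_e\ge k-\sum_{l<k}(k-l)(x^l_i+x^l_{i'})$ for all $k\in\{1,\ldots,|V|\}$, $e=\{i,i'\}\in E$. (F2): minimize $\sum_{e\in E}\sum_{k=1}^{|V|}k\,d^k_e$ subject to $\sum_i x^k_i=1$ for all $k\in\{1,\ldots,|V|\}$, $\sum_k x^k_i=1$ for all $i\in\{1,\ldots,|V|\}$, $x^k_i\in\{0,1\}$ for all $i,k\in\{1,\ldots,|V|\}$, $\sum_{k}d^k_e=1$ for all $e\in E$, $d^k_e\le x^k_i+x^k_{i'}$ for all $k$ and all $e=\{i,i'\}\in E$, and $d^k_e\in\{0,1\}$. *)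

(* Defs.v *)
From mathcomp Require Import all_boot all_order all_algebra.

Set Implicit Arguments.
Unset Strict Implicit.
Unset Printing Implicit Defensive.

Import Order.TTheory GRing.Theory Num.Theory.
Local Open Scope ring_scope.

Record sgraph (V : finType) := SGraph {
  edges : {set {set V}};
  edges_card2 : forall e : {set V}, e \in edges -> #|e| = 2%N
}.

Definition edge (V : finType) (G : sgraph V) := {e : {set V} | e \in edges G}.

(* 'I_n enumerates 0, ..., n - 1, whereas the labels are 1, ..., n: the index
   k : 'I_n stands for the label k + 1. *)
Definition label (R : realFieldType) (n : nat) (k : 'I_n) : R := k.+1%:R.

(* Throughout, x i k is the variable x^k_i: rows of x are nodes, columns are
   labels.  Conditions on e = {i, i'} are quantified over all pairs of nodes
   i, i' with val e = [set i; i'], hence over both orders of the endpoints. *)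

Definition binary_assignment (R : realFieldType) (n : nat) (x : 'M[R]_n)
    : Prop :=
  [/\ forall i k : 'I_n, x i k = 0 \/ x i k = 1,
      forall k : 'I_n, \sum_(i < n) x i k = 1
    & forall i : 'I_n, \sum_(k < n) x i k = 1].

Definition F1_feasible (R : realFieldType) (n : nat) (G : sgraph 'I_n)
    (x : 'M[R]_n) (theta : edge G -> R) : Prop :=
  [/\ binary_assignment x,
      forall e : edge G, 0 <= theta e
    & forall (k : 'I_n) (e : edge G) (i i' : 'I_n), val e = [set i; i'] ->
        label R k -
          \sum_(l < n | (l < k)%N) (label R k - label R l) * (x i l + x i' l)
        <= theta e].

(* d e k is the variable d^k_e. *)
Definition F2_relaxed_feasible (R : realFieldType) (n : nat) (G : sgraph 'I_n)
    (x : 'M[R]_n) (d : edge G -> 'I_n -> R) : Prop :=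
  [/\ binary_assignment x,
      forall (e : edge G) (k : 'I_n), 0 <= d e k,
      forall e : edge G, \sum_(k < n) d e k = 1
    & forall (k : 'I_n) (e : edge G) (i i' : 'I_n), val e = [set i; i'] ->
        d e k <= x i k + x i' k].

(* Main.v *)
(** Fix an edge [e = {i, i'}].  For any [d] as in (ii),
    [k - sum_(l < k) (k - l) d_l = sum_l (min k l) d_l <= sum_l l d_l], and
    replacing [d_l] by the larger [x^l_i + x^l_i'] decreases the left-hand side.
    Conversely, if [m] is the smallest label on [e], the (F1) inequality at
    [k = m] reads [theta_e >= m], so the indicator of [m] is a suitable [d]. *)

Require Import Defs.
From mathcomp Require Import all_boot all_order all_algebra.

Set Implicit Arguments.
Unset Strict Implicit.
Unset Printing Implicit Defensive.

Import Order.TTheory GRing.Theory Num.Theory.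
Local Open Scope ring_scope.

Lemma label_sub_sum_le (R : realFieldType) (n : nat) (d : 'I_n -> R)
    (k : 'I_n) :
  (forall l, 0 <= d l) -> \sum_(l < n) d l = 1 ->
  label R k - \sum_(l < n | (l < k)%N) (label R k - label R l) * d l
    <= \sum_(l < n) label R l * d l.
Proof.
move=> d_ge0 d_sum1.
(* Multiplying [label R k] by the total mass 1 of [d] puts both sides over the same index set, so
   the comparison becomes termwise. *)
rewrite -[X in X - _]mulr1 -d_sum1 mulr_sumr [X in _ - X]big_mkcond -sumrB /=.
apply: ler_sum => l _; case: ltnP => [_ | le_kl].
  by rewrite -mulrBl subKr.
by rewrite subr0 ler_wpM2r // ler_nat ltnS.
Qed.

Lemma binary_assignment_label (R : realFieldType) (n : nat) (x : 'M[R]_n)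
    (i : 'I_n) :
  binary_assignment x -> exists k, x i k = 1.
Proof.
case=> x01 _ row_sum1; case: (pickP [pred k | x i k == 1]) => [k /eqP | x_neq1].
  by exists k.
suff /eqP : \sum_(k < n) x i k = 0 by rewrite row_sum1 oner_eq0.
apply: big1 => k _; case: (x01 i k) => // xik1.
by have := x_neq1 k; rewrite /= xik1 eqxx.
Qed.

(** The first property will bound the indicator of [m] by the sum of the two endpoint entries; the
    second makes the sum in the (F1) inequality at [m] vanish. *)
Lemma edge_min_label (R : realFieldType) (n : nat) (G : sgraph 'I_n)
    (x : 'M[R]_n) (e : edge G) :
  binary_assignment x ->
  exists m : 'I_n,
    (exists2 j, j \in val e & x j m = 1) /\
    (forall j (l : 'I_n), j \in val e -> (l < m)%N -> x j l = 0).
Proof.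
move=> hx; have [x01 _ _] := hx.
have /card_gt0P[j0 j0e] : (0 < #|val e|)%N by rewrite (edges_card2 (valP e)).
have [k0 xjk0] := binary_assignment_label j0 hx.
pose used (k : 'I_n) := [exists (j | j \in val e), x j k == 1].
have used_k0 : used k0 by apply/exists_inP; exists j0; rewrite // xjk0.
case: (arg_minnP (fun k : 'I_n => nat_of_ord k) used_k0).
move=> m /exists_inP[j je /eqP xjm] m_min; exists m; split; first by exists j.
move=> j' l j'e lt_lm; case: (x01 j' l) => // xjl1.
have /m_min : used l by apply/exists_inP; exists j'; rewrite // xjl1.
by rewrite leqNgt lt_lm.
Qed.

Theorem mainTheorem2 (R : realFieldType) (n : nat) (G : sgraph 'I_n)
    (x : 'M[R]_n) (theta : edge G -> R)
    (hx : binary_assignment x)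
    (htheta : forall e : edge G, 0 <= theta e) :
  F1_feasible x theta <->
  exists d : edge G -> 'I_n -> R,
    F2_relaxed_feasible x d /\
    (forall e : edge G, \sum_(k < n) label R k * d e k <= theta e).
Proof.
split=> [[_ _ theta_ge] | [d [[_ d_ge0 d_sum1 d_le] theta_ge]]]; last first.
  split=> // k e i i' e_ii'.
  apply: le_trans (theta_ge e).
  apply: le_trans (label_sub_sum_le k (d_ge0 e) (d_sum1 e)).
  rewrite lerB //; apply: ler_sum => l lt_lk.
  by rewrite ler_wpM2l ?d_le // subr_ge0 ler_nat ltnS ltnW.
have [x01 _ _] := hx.
have x_ge0 i k : 0 <= x i k by case: (x01 i k) => ->.
(* Since [edge G] is finite, the minimal labels can be chosen for all edges at once without a choice
   axiom. *)
have [m m_min] := fin_all_exists (fun e : edge G => edge_min_label e hx).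
exists (fun e k => (k == m e)%:R); split.
  split=> // [e | k e i i' e_ii'].
    by rewrite (bigD1 (m e)) //= eqxx big1 ?addr0 // => k /negbTE ->.
  have [-> | _] := eqVneq k (m e); last by rewrite addr_ge0.
  (* One endpoint contributes 1 at the label [m e] and the other a nonnegative entry, in either
     order of [i] and [i']. *)
  have [[j je xj1] _] := m_min e.
  by move: je; rewrite e_ii' => /set2P[] <-; rewrite xj1 (lerDl, lerDr).
move=> e; rewrite (bigD1 (m e)) //= eqxx mulr1 big1 ?addr0; last first.
  by move=> k /negbTE ->; rewrite mulr0.
(* The (F1) inequality is stated for a presentation of [e] as a pair, so one is extracted from its
   cardinality. *)
have /eqP/cards2P[i [i' [_ e_ii']]] := edges_card2 (valP e).
have [_ x0] := m_min e.
apply: le_trans (theta_ge (m e) e i i' e_ii').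
rewrite big1 ?subr0 // => l lt_lm.
by rewrite !x0 ?addr0 ?mulr0 // e_ii' !inE eqxx ?orbT.
Qed.
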